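(* Let $(k_1,\dots,k_n)\in\mathbb{Z}^n$ be arbitrary. The (signed) generating function of extended arrowed monotone triangles with bottom row $(k_1,\dots,k_n)$ equals $$\prod_{i=1}^n\left(\omega(\nearrow)X_i+\omega(\nwarrow)X_i^{-1}+\omega(\nwarrow\!\nearrow)+\omega(\emptyset)\right)\prod_{1\le p<q\le n}\left(\omega(\nearrow)E_{k_p}+\omega(\nwarrow)E_{k_q}^{-1}+\omega(\nwarrow\!\nearrow)E_{k_p}E_{k_q}^{-1}+\omega(\emptyset)\,\mathrm{id}\right)s_{(k_n,\dots,k_1)}(X_1,\dots,X_n),$$ with the operator product expanded and applied to $(k_1,\dots,k_n)\mapsto s_{(k_n,\dots,k_1)}$ as a function on $\mathbb{Z}^n$ before evaluation.
   Context: Signed interval for $a,b\in\mathbb{Z}$: $\langle a,b\rangle=([a,b],\emptyset)$ if $a\le b$; $=(\emptyset,[b+1,a-1])$ if $b+1\le a-1$; $=(\emptyset,\emptyset)$ if $b+1=a$; the interval is negative iff its positive part is empty and its negative part nonempty, and ''$x\in\langle a,b\rangle$'' means $x$ lies in the positive or negative part. An extended arrowed monotone triangle is a triangular array $(a_{i,j})_{1\le j\le i\le n}$ of integers, each decorated with an element of $\{\nwarrow,\nearrow,\nwarrow\!\nearrow,\emptyset\}$, such that for every $a=a_{i,j}$ with $i<n$, with $b=a_{i+1,j}$, $c=a_{i+1,j+1}$: $a\in\langle b+\epsilon_b,\,c-\delta_c\rangle$, where $\epsilon_b=1$ if $b$ carries $\nearrow$ or $\nwarrow\!\nearrow$ and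 $0$ otherwise, and $\delta_c=1$ if $c$ carries $\nwarrow$ or $\nwarrow\!\nearrow$ and $0$ otherwise. Its sign is $(-1)^N$ where $N$ is the number of pairs $(i,j)$, $2\le i\le n$, $j<i$, for which the interval $\langle a_{i,j}+\epsilon_{a_{i,j}},a_{i,j+1}-\delta_{a_{i,j+1}}\rangle$ is negative. Its weight is $\omega(\nearrow)^{\#\nearrow}\omega(\nwarrow)^{\#\nwarrow}\omega(\nwarrow\!\nearrow)^{\#\nwarrow\nearrow}\omega(\emptyset)^{\#\emptyset}\prod_iX_i^{\sum_ja_{i,j}-\sum_ja_{i-1,j}+\#\nearrow\text{ in row }i-\#\nwarrow\text{ in row }i}$; the generating function is the sum of sign times weight. $E_x$ is the shift $E_xp(x)=p(x+1)$. Extended Schur polynomial: for $\lambda\in\mathbb{Z}^n$, $s_\lambda=0$ if $\lambda_i-i=\lambda_j-j$ for some $i<j$; else with $\sigma$ such that $\lambda_{\sigma(1)}-\sigma(1)>\dots>\lambda_{\sigma(n)}-\sigma(n)$ and integer $p\ge0$ with $\lambda_{\sigma(n)}+n-\sigma(n)+p\ge0$, $s_\lambda=\operatorname{sgn}(\sigma)s_\mu\prod X_i^{-p}$, $\mu_i=\lambda_{\sigma(i)}+i-\sigma(i)+p$. *)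

(* Defs.v *)
From mathcomp Require Import all_boot all_order all_algebra all_fingroup.
Set Implicit Arguments. Unset Strict Implicit. Unset Printing Implicit Defensive.
Import Order.TTheory GRing.Theory Num.Theory.
Local Open Scope ring_scope.

Inductive arrow := NE | NW | NWNE | EMP.

Definition eps (a : arrow) : int := match a with NE | NWNE => 1 | _ => 0 end.
Definition delta (a : arrow) : int := match a with NW | NWNE => 1 | _ => 0 end.

Definition isNE (a : arrow) : bool := if a is NE then true else false.
Definition isNW (a : arrow) : bool := if a is NW then true else false.

Definition int_range (a b : int) : seq int :=
  if a <= b then [seq a + (i%:Z) | i <- iota 0 (absz (b - a + 1))] else [::].

(* elements of the signed interval <a,b> (positive part, or negative part) *)
Definition sint_elems (a b : int) : seq int :=
  if a <= b then int_range a b else int_range (b + 1) (a - 1).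

(* <a,b> is negative: positive part empty and negative part [b+1,a-1] nonempty *)
Definition sint_neg (a b : int) : bool := b + 1 < a.

Fixpoint choices (ls : seq (seq int)) : seq (seq int) :=
  if ls is l :: ls' then [seq x :: s | x <- l, s <- choices ls'] else [:: [::]].

Fixpoint decos (m : nat) : seq (seq arrow) :=
  if m is m'.+1 then [seq a :: s | a <- [:: NE; NW; NWNE; EMP], s <- decos m']
  else [:: [::]].

Definition ends (r : seq int) (d : seq arrow) : seq (int * int) :=
  let z := zip r d in
  [seq (x.1.1 + eps x.1.2, x.2.1 - delta x.2.2) | x <- zip z (behead z)].

(* Signed generating function of extended arrowed monotone triangles with
   m rows and bottom row r (of length m); row i uses the variable X i (1-based).
   At each level the decorations d of row m are chosen, then row m-1 ranges
   over all rows whose j-th entry lies in <r_j + eps, r_{j+1} - delta>. *)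
Fixpoint emt_gf (R : fieldType) (w : arrow -> R) (X : nat -> R)
    (m : nat) (r : seq int) : R :=
  if m is m'.+1 then
    \sum_(d <- decos m)
      \sum_(r' <- choices [seq sint_elems e.1 e.2 | e <- ends r d])
        ((-1) ^+ count (fun e => sint_neg e.1 e.2) (ends r d)
         * \prod_(a <- d) w a
         * X m ^ (\sum_(x <- r) x - \sum_(x <- r') x
                  + (count isNE d)%:Z - (count isNW d)%:Z)
         * emt_gf w X m' r')
  else 1.

(* Ordinary Schur polynomial s_mu(X_1,...,X_m) for a partition mu
   (weakly decreasing, nonnegative, of length m), defined combinatorially as the
   generating function of Gelfand-Tsetlin patterns with bottom row mu. *)
Fixpoint gt_schur (R : fieldType) (X : nat -> R) (m : nat) (mu : seq int) : R :=
  if m is m'.+1 then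
    \sum_(mu' <- choices [seq int_range x.2 x.1 | x <- zip mu (behead mu)])
      X m ^ (\sum_(x <- mu) x - \sum_(x <- mu') x) * gt_schur X m' mu'
  else 1.

(* Extended Schur polynomial s_lam(X_1,...,X_n) for lam in Z^n (n = size lam);
   indices are 0-based here, which does not affect the definition since only
   differences i - sigma(i), (lam_i - i) - (lam_j - j) matter.  p is chosen as
   the least admissible nonnegative integer. *)
Definition ext_schur (R : fieldType) (X : nat -> R) (lam : seq int) : R :=
  let n := size lam in
  let v := fun i : 'I_n => nth 0 lam i - (i : nat)%:Z in
  if [exists i : 'I_n, exists j : 'I_n, (i < j)%N && (v i == v j)] then 0 else
  match [pick s : {perm 'I_n} |
           [forall i : 'I_n, forall j : 'I_n, (i < j)%N ==> (v (s j) < v (s i))]] with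
  | Some s =>
      let mu0 := [seq nth 0 lam (s i) + (i : nat)%:Z - (s i : nat)%:Z | i <- enum 'I_n] in
      let l := last 0 mu0 in
      let p : nat := if l < 0 then absz l else 0%N in
      (-1) ^+ odd_perm s * gt_schur X n [seq x + p%:Z | x <- mu0]
        * \prod_(1 <= i < n.+1) X i ^- p
  | None => 0
  end.

(* shift operators on functions Z^n -> R (vectors as seq int, index p 1-based) *)
Definition shiftv (k : seq int) (p : nat) (c : int) : seq int :=
  set_nth 0 k p.-1 (nth 0 k p.-1 + c).

Definition Eop (R : fieldType) (p : nat) (f : seq int -> R) : seq int -> R :=
  fun k => f (shiftv k p 1).
Definition Einv (R : fieldType) (q : nat) (f : seq int -> R) : seq int -> R :=
  fun k => f (shiftv k q (-1)).

Definition pair_op (R : fieldType) (w : arrow -> R) (p q : nat)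
    (f : seq int -> R) : seq int -> R :=
  fun k => w NE * Eop p f k + w NW * Einv q f k
           + w NWNE * Eop p (Einv q f) k + w EMP * f k.

Definition pairs (n : nat) : seq (nat * nat) :=
  [seq (p, q) | p <- iota 1 n, q <- iota p.+1 (n - p)].

(* the composite of the (commuting) operators pair_op p q over 1 <= p < q <= n *)
Definition big_op (R : fieldType) (w : arrow -> R) (n : nat)
    (f : seq int -> R) : seq int -> R :=
  foldr (fun pq g => pair_op w pq.1 pq.2 g) f (pairs n).

(* Main.v *)
Require Import Defs.
From mathcomp Require Import all_boot all_order all_algebra all_fingroup.
From mathcomp Require Import zify ring.
From Stdlib Require Import FunctionalExtensionality.
Import Order.TTheory GRing.Theory Num.Theory.
Local Open Scope ring_scope.
Set Implicit Arguments. Unset Strict Implicit. Unset Printing Implicit Defensive.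

(** In the coordinates [v_j = k_j + j] (0-based) the condition
    [l_j \in <k_j, k_{j+1}>] becomes half-open, [l_j \in [v_j, v_{j+1})], so signed
    sums are differences of an antiderivative, and the extended Schur polynomials
    become alternating functions of [v].  Let [U] be an antiderivative, in all
    variables, of an alternating function.  A signed sum over a decorated row is
    then an alternating sum of values of [U] over the choices, for every [j], of
    the lower or the upper end point.  If node [j+1] provides both the upper end
    of [l_j] and the lower end of [l_{j+1}], summing over its decoration applies
    the pair operator with [j+1] and [j] exchanged; together with the pair
    operator [(j, j+1)] it forms a symmetric operator, which sends [U] to a
    function vanishing on [l_j = l_{j+1}].  Only the words L..LR..R remain: they
    leave a single node [i] unused, and there the decorations produce exactly the
    pair operators [(p, i)] and [(i, q)] acting on a function independent of
    [v_i].  The variable [X_n] is absorbed into the weights. *)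

(** * Signed sums over integer intervals *)

Section SignedSum.
Variable R : nzRingType.
Implicit Types (f : int -> R) (a b c : int).

(** Normalised to vanish at 0 and continued to negative arguments so that the forward difference is
    [f] on all of $\mathbb{Z}$. *)
Definition primitive f (x : int) : R :=
  match x with
  | Posz n => \sum_(i < n) f i%:Z
  | Negz n => - \sum_(i < n.+1) f (Negz i)
  end.

Lemma primitiveD1 f x : primitive f (x + 1) = primitive f x + f x.
Proof.
case: x => [n|[|n]].
- rewrite (_ : n%:Z + 1 = n.+1%:Z) /=; last by lia.
  by rewrite big_ord_recr.
- by rewrite (_ : Negz 0 + 1 = 0%:Z) //= big_ord_recr !big_ord0 /= add0r addNr.
- rewrite (_ : Negz n.+1 + 1 = Negz n) /=; last by lia.
  by rewrite [X in _ = - X + _]big_ord_recr /= opprD addrNK.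
Qed.

Definition isum a b f : R := primitive f b - primitive f a.

Lemma isum0 f b : isum 0 b f = primitive f b.
Proof. by rewrite /isum /= big_ord0 subr0. Qed.

Lemma isum_split a b f : isum a b f = isum 0 b f - isum 0 a f.
Proof. by rewrite !isum0. Qed.

Lemma isumC a b f : isum a b f = - isum b a f.
Proof. by rewrite /isum opprB. Qed.

Lemma isum_nat a n f : isum a (a + n%:Z) f = \sum_(i <- iota 0 n) f (a + i%:Z).
Proof.
elim: n => [|n IH]; first by rewrite big_nil addr0 /isum subrr.
rewrite -addn1 iotaD big_cat big_seq1 /= add0n -IH PoszD addrA /isum primitiveD1.
by rewrite addrAC.
Qed.

Lemma eq_isum a b f g : f =1 g -> isum a b f = isum a b g.
Proof.
by move=> fg; have -> : f = g by apply: functional_extensionality.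
Qed.

Lemma isum_shift a b c f : isum (a + c) (b + c) f = isum a b (fun x => f (x + c)).
Proof.
(* Only differences can agree: the two primitives are each normalised at 0 and so differ by a
   constant. *)
suff E x y : primitive (fun x => f (x + c)) y - primitive (fun x => f (x + c)) x
     = primitive f (y + c) - primitive f (x + c) by rewrite /isum E.
wlog xy : x y / x <= y.
  move=> W; have [/W//|/ltW/W/(congr1 -%R)] := leP x y.
  by rewrite !opprB.
have -> : y = x + `|y - x|%N%:Z by lia.
elim: `|y - x|%N => [|n IH]; first by rewrite addr0 !subrr.
rewrite (_ : x + n.+1%:Z = x + n%:Z + 1); last by lia.
rewrite (addrAC _ 1) !primitiveD1 [LHS]addrAC IH.
by rewrite [RHS]addrAC.
Qed.

Lemma isum_lin (T : Type) (s : seq T) (k : T -> R) (f : T -> int -> R) a b :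
  isum a b (fun x => \sum_(t <- s) k t * f t x) = \sum_(t <- s) k t * isum a b (f t).
Proof.
have E x : primitive (fun x => \sum_(t <- s) k t * f t x) x
         = \sum_(t <- s) k t * primitive (f t) x.
  case: x => n /=; rewrite exchange_big /= -?sumrN; apply: eq_bigr => t _.
    by rewrite mulr_sumr.
  by rewrite mulrN mulr_sumr.
by rewrite /isum !E -sumrB; apply: eq_bigr => t _; rewrite mulrBr.
Qed.

Lemma isumB a b f g : isum a b (fun x => f x - g x) = isum a b f - isum a b g.
Proof.
have /= := isum_lin [:: true; false] (fun t : bool => (-1) ^+ ~~ t)
  (fun (t : bool) x => if t then f x else g x) a b.
rewrite !big_cons !big_nil /= expr0 expr1 mul1r mulN1r addr0 => <-.
by apply: eq_isum => x; rewrite !big_cons big_nil /= expr0 expr1 mul1r mulN1r addr0.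
Qed.

Lemma isum_exchange a b c d (f : int -> int -> R) :
  isum a b (fun x => isum c d (f x)) = isum c d (fun y => isum a b (f^~ y)).
Proof.
have E x y : primitive (fun x => primitive (f x) y) x =
             primitive (fun y => primitive (f^~ y) x) y.
  by case: x y => [m|m] [n|n] /=; rewrite ?sumrN ?opprK exchange_big.
have P (g h : int -> R) x :
  primitive (fun x => g x - h x) x = primitive g x - primitive h x.
  by rewrite -!isum0 isumB.
rewrite /isum !P (E b d) (E b c) (E a d) (E a c).
by rewrite !opprB addrACA [RHS]addrACA [X in _ + X = _]addrC; congr (_ + _); rewrite addrC.
Qed.

End SignedSum.

(** The positive part is $[a,b+1)$ and the negative part is $[b+1,a)$ read backwards, so the sign is
    the orientation of [isum]; for $b+1=a$ both parts are empty. *)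
Lemma sint_sum (R : fieldType) (a b : int) (f : int -> R) :
  (-1) ^+ sint_neg a b * \sum_(x <- sint_elems a b) f x = isum a (b + 1) f.
Proof.
rewrite /sint_neg /sint_elems /int_range.
have [ab|ba] := leP a b.
  have -> : (b + 1 < a) = false by lia.
  rewrite expr0 mul1r big_map -isum_nat; congr isum; lia.
have [ba'|ba'] := leP (b + 1) (a - 1).
  have -> : b + 1 < a by lia.
  rewrite expr1 mulN1r big_map isumC -isum_nat; congr (- isum _ _ _); lia.
have -> : (b + 1 < a) = false by lia.
rewrite big_nil mulr0 (_ : b + 1 = a) /isum ?subrr //; lia.
Qed.

(** * Iterated signed sums and shift operators *)

Definition scons (T : Type) (x : T) (v : nat -> T) : nat -> T :=
  fun i => if i is i'.+1 then v i' else x.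

(** Vectors of length [m] are encoded as total functions on [nat], which frees shifts and
    permutations from bounds; this predicate controls the dummy tail. *)
Definition depends_on_first (T U : Type) (m : nat) (F : (nat -> T) -> U) : Prop :=
  forall u v, (forall i, (i < m)%N -> u i = v i) -> F u = F v.

Definition swapn (j t : nat) : nat :=
  if t == j then j.+1 else if t == j.+1 then j else t.

Lemma swapnK j : involutive (swapn j).
Proof.
move=> t; rewrite /swapn.
case: (eqVneq t j) => [->|tj]; first by rewrite gtn_eqF // eqxx.
case: (eqVneq t j.+1) => [->|tj1]; first by rewrite eqxx.
by rewrite (negPf tj) (negPf tj1).
Qed.

Section MultiSum.
Variable R : nzRingType.
Implicit Types (a b c l v : nat -> int) (F g : (nat -> int) -> R).

Fixpoint msum (m : nat) a b F : R :=
  if m is m'.+1 then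
    isum (a 0%N) (b 0%N) (fun x =>
      msum m' (fun i => a i.+1) (fun i => b i.+1) (fun v => F (scons x v)))
  else F (fun=> 0).

Lemma eq_msum m a b F g : F =1 g -> msum m a b F = msum m a b g.
Proof. by move=> fg; have -> : F = g by apply: functional_extensionality. Qed.

Lemma msum_lin (T : Type) (s : seq T) (k : T -> R) (f : T -> (nat -> int) -> R) m a b :
  msum m a b (fun x => \sum_(t <- s) k t * f t x)
  = \sum_(t <- s) k t * msum m a b (f t).
Proof.
elim: m a b f => [//|m IH] a b f /=.
by rewrite -isum_lin; apply: eq_isum => x; rewrite IH.
Qed.

Lemma msumZ m a b k F : msum m a b (fun v => k * F v) = k * msum m a b F.
Proof.
have /= := msum_lin [:: tt] (fun=> k) (fun=> F) m a b.
by rewrite big_seq1 => <-; apply: eq_msum => x; rewrite big_seq1.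
Qed.

Lemma msumB m a b F g :
  msum m a b (fun v => F v - g v) = msum m a b F - msum m a b g.
Proof.
elim: m a b F g => [//|m IH] a b F g /=.
by rewrite -isumB; apply: eq_isum => x; rewrite IH.
Qed.

Lemma msum_bounds m a b a' b' F :
  (forall i, (i < m)%N -> a i = a' i) -> (forall i, (i < m)%N -> b i = b' i) ->
  msum m a b F = msum m a' b' F.
Proof.
elim: m a b a' b' F => [//|m IH] a b a' b' F ha hb /=.
rewrite ha // hb //; apply: eq_isum => x; apply: IH => i im; [exact: ha|exact: hb].
Qed.

(** [msum] fills the tail with 0, which the substitution would turn into [c i]; hence the hypothesis
    on [F]. *)
Lemma msum_shift m a b c F : depends_on_first m F ->
  msum m (fun i => a i + c i) (fun i => b i + c i) F
  = msum m a b (fun v => F (fun i => v i + c i)).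
Proof.
elim: m a b c F => [|m IH] a b c F dF /=; first exact: dF.
rewrite isum_shift; apply: eq_isum => x.
rewrite (IH _ _ (fun i => c i.+1)) => [|u v uv]; last by apply: dF; case=> //.
by apply: eq_msum => v; congr F; apply: functional_extensionality; case.
Qed.

Lemma msum_swap m a b j F : (j.+1 < m)%N ->
  msum m a b (fun v => F (fun i => v (swapn j i)))
  = msum m (fun i => a (swapn j i)) (fun i => b (swapn j i)) F.
Proof.
elim: j m a b F => [|j IH] [|[|m]] // a b F jm /=.
  rewrite isum_exchange; apply: eq_isum => x; apply: eq_isum => y.
  by apply: eq_msum => v; congr F; apply: functional_extensionality => -[|[]].
apply: eq_isum => x.
transitivity (msum m.+1 (fun i => a i.+1) (fun i => b i.+1)
    (fun v => F (scons x (fun i => v (swapn j i))))).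
  apply: (@eq_msum m.+1 _ _ (fun v => F (fun i => scons x v (swapn j.+1 i)))) => v; congr F.
  apply: functional_extensionality => -[|i] //=.
  by rewrite /swapn !eqSS; do ![case: ifP => //].
rewrite (IH m.+1 _ _ (fun v => F (scons x v))) //.
have S i : swapn j.+1 i.+1 = (swapn j i).+1.
  by rewrite /swapn !eqSS; do ![case: ifP => //].
by apply: (@msum_bounds m.+1 _ _ (fun i => a (swapn j.+1 i.+1))
  (fun i => b (swapn j.+1 i.+1)) (fun v => F (scons x v))) => i _; rewrite S.
Qed.

(* Words in {lower, upper}: [true] selects the upper bound; the default beyond [m] is [true]. *)
Fixpoint wsum (m : nat) (Om : (nat -> bool) -> R) : R :=
  if m is m'.+1 then
    wsum m' (fun s => Om (scons true s)) - wsum m' (fun s => Om (scons false s))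
  else Om (fun=> true).

Lemma eq_wsum m (f g : (nat -> bool) -> R) : f =1 g -> wsum m f = wsum m g.
Proof. by move=> fg; have -> : f = g by apply: functional_extensionality. Qed.

Lemma wsum_lin (T : Type) (s : seq T) (k : T -> R) (f : T -> (nat -> bool) -> R) m :
  wsum m (fun x => \sum_(t <- s) k t * f t x) = \sum_(t <- s) k t * wsum m (f t).
Proof.
elim: m f => [//|m IH] f /=.
by rewrite !IH -sumrB; apply: eq_bigr => t _; rewrite mulrBr.
Qed.

Lemma wsum_isum m (f : int -> (nat -> bool) -> R) (a b : int) :
  isum a b (fun x => wsum m (f x)) = wsum m (fun s => isum a b (f^~ s)).
Proof.
elim: m f => [//|m IH] f /=.
by rewrite isumB !IH.
Qed.

Lemma wsum_true m (Om : (nat -> bool) -> R) :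
  (forall s j, (j < m)%N -> s j = true -> s j.+1 = false -> Om s = 0) ->
  wsum m (fun s => Om (scons true s)) = Om (fun=> true).
Proof.
elim: m Om => [|m IH] Om vO /=.
  by congr Om; apply: functional_extensionality => -[].
rewrite (IH (fun s => Om (scons true s))); last first.
  by move=> s j jm sj sj'; apply: (vO _ j.+1).
have -> : wsum m (fun s => Om (scons true (scons false s))) = wsum m (fun=> 0).
  by apply: eq_wsum => s; apply: (vO _ 0%N).
have -> : wsum m (fun=> 0) = 0 by elim: (m) => //= k ->; rewrite subrr.
by rewrite subr0; congr Om; apply: functional_extensionality => -[].
Qed.

(** A surviving word never has an upper end followed by a lower one: it consists of [i] lower ends,
    each with a minus sign, and then upper ends only. *)
Lemma wsum_monotone m (Om : (nat -> bool) -> R) :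
  (forall s j, (j.+1 < m)%N -> s j = true -> s j.+1 = false -> Om s = 0) ->
  wsum m Om = \sum_(i <- iota 0 m.+1) (-1) ^+ i * Om (fun j => (i <= j)%N).
Proof.
elim: m Om => [|m IH] Om vO /=.
  by rewrite big_seq1 expr0 mul1r; congr Om.
rewrite wsum_true => [|s j jm]; last exact: vO.
rewrite big_cons expr0 mul1r; congr (Om _ + _).
rewrite (IH (fun s => Om (scons false s))); last first.
  by move=> s j jm sj sj'; apply: (vO _ j.+1).
rewrite -sumrN (_ : 1%N :: iota 2 m = iota (1 + 0) m.+1) // iotaDl big_map.
apply: eq_bigr => i _; rewrite add1n exprS mulN1r mulNr; congr (- (_ * Om _)).
by apply: functional_extensionality => -[].
Qed.

Definition pick_bound (s : nat -> bool) a b : nat -> int :=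
  fun i => if s i then b i else a i.

(** Each sum is a difference of sums based at 0, so [fun l => msum m (fun=> 0) l F] serves as an
    antiderivative in all variables at once. *)
Lemma msum_wsum m a b F :
  msum m a b F = wsum m (fun s => msum m (fun=> 0) (pick_bound s a b) F).
Proof.
elim: m a b F => [//|m IH] a b F /=.
rewrite -!wsum_isum -isum_split.
by apply: eq_isum => x; rewrite IH.
Qed.

Lemma msum_dep m a F : depends_on_first m (fun l => msum m a l F).
Proof. by move=> u v uv; apply: msum_bounds. Qed.

End MultiSum.

(** * Pair operators and weighted sums over the decorations of a row *)

Definition arrows : seq arrow := [:: NE; NW; NWNE; EMP].

Definition arrow_shift (a : arrow) (p q : nat) (v : nat -> int) : nat -> int :=
  fun t => v t + eps a *+ (t == p) - delta a *+ (t == q).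

Section PairOperators.
Variables (R : comNzRingType) (w : arrow -> R).
Implicit Types (v l : nat -> int) (F g : (nat -> int) -> R) (L : seq (nat * nat)).

Definition shift_op (pq : nat * nat) F v : R :=
  \sum_(a <- arrows) w a * F (arrow_shift a pq.1 pq.2 v).

Definition shift_ops L F : (nat -> int) -> R := foldr shift_op F L.

Lemma shift_opC x y F : shift_op x (shift_op y F) = shift_op y (shift_op x F).
Proof.
apply: functional_extensionality => v; rewrite /shift_op.
under eq_bigr => a _ do rewrite mulr_sumr.
rewrite exchange_big /=; apply: eq_bigr => b _; rewrite mulr_sumr.
apply: eq_bigr => a _; rewrite mulrCA; congr (_ * (_ * F _)).
apply: functional_extensionality => t; rewrite /arrow_shift; ring.
Qed.

Lemma shift_ops_cat L L' F : shift_ops (L ++ L') F = shift_ops L (shift_ops L' F).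
Proof. exact: foldr_cat. Qed.

Lemma shift_opsC1 x L F : shift_ops L (shift_op x F) = shift_op x (shift_ops L F).
Proof. by elim: L => //= y L ->; rewrite shift_opC. Qed.

Lemma shift_ops_cons x L F : shift_ops (x :: L) F = shift_ops L (shift_op x F).
Proof. by rewrite shift_opsC1. Qed.

Lemma perm_shift_ops L L' F : perm_eq L L' -> shift_ops L F = shift_ops L' F.
Proof.
elim: L L' => [|x L IH] L' pL.
  by move: pL; rewrite perm_sym => /perm_nilP ->.
have xL' : x \in L' by rewrite -(perm_mem pL) mem_head.
case/splitPr: xL' pL => L1 L2.
rewrite perm_sym -cat1s perm_catCA perm_cons perm_sym => /IH /= ->.
by rewrite !shift_ops_cat /= shift_opsC1.
Qed.

Lemma shift_op_lin (T : Type) (s : seq T) (k : T -> R) (f : T -> (nat -> int) -> R) x v :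
  shift_op x (fun u => \sum_(t <- s) k t * f t u) v
  = \sum_(t <- s) k t * shift_op x (f t) v.
Proof.
rewrite /shift_op; under eq_bigr => a _ do rewrite mulr_sumr.
rewrite exchange_big; apply: eq_bigr => t _; rewrite mulr_sumr.
by apply: eq_bigr => a _; rewrite mulrCA.
Qed.

Lemma shift_ops_lin (T : Type) (s : seq T) (k : T -> R) (f : T -> (nat -> int) -> R) L v :
  shift_ops L (fun u => \sum_(t <- s) k t * f t u) v
  = \sum_(t <- s) k t * shift_ops L (f t) v.
Proof.
elim: L v => [//|x L IH] v /=.
by rewrite -shift_op_lin; congr shift_op; apply: functional_extensionality.
Qed.

Lemma shift_opsZ L k F v : shift_ops L (fun u => k * F u) v = k * shift_ops L F v.
Proof.
have /= := shift_ops_lin [:: tt] (fun=> k) (fun=> F) L v.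
rewrite big_seq1 => <-; congr shift_ops.
by apply: functional_extensionality => x; rewrite big_seq1.
Qed.

Lemma shift_opsB L F g v :
  shift_ops L (fun u => F u - g u) v = shift_ops L F v - shift_ops L g v.
Proof.
have /= := shift_ops_lin [:: true; false] (fun t : bool => (-1) ^+ ~~ t)
  (fun (t : bool) x => if t then F x else g x) L v.
rewrite !big_cons !big_nil /= expr0 expr1 mul1r mulN1r addr0 => <-.
congr shift_ops; apply: functional_extensionality => u.
by rewrite !big_cons big_nil /= expr0 expr1 mul1r mulN1r addr0.
Qed.

Lemma shift_ops_reindex (s : nat -> nat) L F v : injective s ->
  shift_ops L F (fun i => v (s i))
  = shift_ops [seq (s x.1, s x.2) | x <- L] (fun u => F (fun i => u (s i))) v.
Proof.
move=> inj_s; elim: L v => [//|x L IH] v /=.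
rewrite /shift_op /=; apply: eq_bigr => a _; rewrite -IH; congr (_ * shift_ops L F _).
by apply: functional_extensionality => t; rewrite /arrow_shift !(inj_eq inj_s).
Qed.

Lemma shift_ops_dep m L F : depends_on_first m F -> depends_on_first m (shift_ops L F).
Proof.
move=> dF; elim: L => [//|x L IH] u v uv /=.
by rewrite /shift_op; apply: eq_bigr => a _; congr (_ * _); apply: IH => i im; rewrite /arrow_shift uv.
Qed.

(** A shift of the summand's argument moves both ends of an interval alike, so the operators pass
    from the summand to its antiderivative, evaluated at the chosen end points. *)
Lemma wsum_msum_shift_ops m a b L F : depends_on_first m F ->
  msum m a b (shift_ops L F)
  = wsum m (fun s => shift_ops L (fun l => msum m (fun=> 0) l F) (pick_bound s a b)).
Proof.
move=> dF; elim: L a b => [|x L IH] a b /=; first exact: msum_wsum.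
rewrite /shift_op wsum_lin msum_lin; apply: eq_bigr => d _; congr (_ * _).
rewrite /arrow_shift.
have C u : (fun t => u t + eps d *+ (t == x.1) - delta d *+ (t == x.2))
  = (fun t => u t + (eps d *+ (t == x.1) - delta d *+ (t == x.2))).
  by apply: functional_extensionality => t; rewrite addrA.
under eq_msum => v do rewrite C.
rewrite -(msum_shift _ _ (fun t => eps d *+ (t == x.1) - delta d *+ (t == x.2)));
  last exact: shift_ops_dep.
rewrite IH; apply: eq_wsum => s; congr shift_ops.
by apply: functional_extensionality => t; rewrite /pick_bound; case: ifP => _; rewrite addrA.
Qed.

Fixpoint deco_sum (n : nat) (Phi : (nat -> arrow) -> R) : R :=
  if n is n'.+1 then
    \sum_(a <- arrows) w a * deco_sum n' (fun d => Phi (scons a d))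
  else Phi (fun=> EMP).

Lemma eq_deco_sum n (f g : (nat -> arrow) -> R) : f =1 g -> deco_sum n f = deco_sum n g.
Proof. by move=> fg; have -> : f = g by apply: functional_extensionality. Qed.

Lemma deco_sumB n (f g : (nat -> arrow) -> R) :
  deco_sum n (fun d => f d - g d) = deco_sum n f - deco_sum n g.
Proof.
elim: n f g => [//|n IH] f g /=.
by rewrite -sumrB; apply: eq_bigr => a _; rewrite IH mulrBr.
Qed.

Lemma deco_sumZ n k (f : (nat -> arrow) -> R) :
  deco_sum n (fun d => k * f d) = k * deco_sum n f.
Proof.
elim: n f => [//|n IH] f /=.
by rewrite mulr_sumr; apply: eq_bigr => a _; rewrite IH mulrCA.
Qed.

Lemma deco_sum_wsum n m (f : (nat -> arrow) -> (nat -> bool) -> R) :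
  deco_sum n (fun d => wsum m (f d)) = wsum m (fun s => deco_sum n (f^~ s)).
Proof.
elim: m f => [//|m IH] f /=.
by rewrite deco_sumB !IH.
Qed.

(** The nodes act independently, so the weighted sum over decorations factors into one pair operator
    per node. *)
Lemma deco_sum_shift_ops n (p q : nat -> nat) F v :
  deco_sum n (fun d => F (fun t => v t +
     \sum_(i <- iota 0 n) (eps (d i) *+ (t == p i) - delta (d i) *+ (t == q i))))
  = shift_ops [seq (p i, q i) | i <- iota 0 n] F v.
Proof.
elim: n p q v => [|n IH] p q v /=.
  by congr F; apply: functional_extensionality => t; rewrite big_nil addr0.
rewrite (_ : [seq (p i, q i) | i <- iota 1 n] = [seq (p i.+1, q i.+1) | i <- iota 0 n]);
  last by rewrite -addn1 addnC iotaDl -map_comp; apply: eq_map.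
apply: eq_bigr => a _; rewrite -IH; congr (_ * _); apply: eq_deco_sum => d.
congr F; apply: functional_extensionality => t.
by rewrite (_ : 1%N = 1 + 0)%N // iotaDl big_cons big_map /arrow_shift /= !addrA.
Qed.

End PairOperators.

(** * Alternating functions and the key identity *)

Definition lt_pairs (n : nat) : seq (nat * nat) :=
  [seq x <- [seq (p, q) | p <- iota 0 n, q <- iota 0 n] | (x.1 < x.2)%N].

Lemma mem_lt_pairs n (x : nat * nat) : (x \in lt_pairs n) = (x.1 < x.2 < n)%N.
Proof.
rewrite mem_filter; apply/andP/andP => -[lt12].
  case/allpairsP => -[p q] [/= _ qn ex]; move: qn lt12.
  by rewrite ex mem_iota.
move=> lt2n; split=> //; apply/allpairsP; exists x; rewrite !mem_iota /=.
by split; [lia|lia|case: (x)].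
Qed.

Lemma uniq_lt_pairs n : uniq (lt_pairs n).
Proof. by rewrite filter_uniq // allpairs_uniq ?iota_uniq // => -[? ?] [? ?]. Qed.

(** The transposition exchanges $(j,j+1)$ with the added pair $(j+1,j)$ and permutes the remaining
    pairs; with this addition the operator becomes symmetric. *)
Lemma swapn_pairs_perm j m : (j.+1 < m)%N ->
  perm_eq [seq (swapn j x.1, swapn j x.2) | x <- (j.+1, j) :: lt_pairs m]
          ((j.+1, j) :: lt_pairs m).
Proof.
move=> jm; set S := (_ :: _).
have inj : injective (fun x => (swapn j x.1, swapn j x.2)).
  by move=> [x y] [x' y'] [/(can_inj (swapnK j)) -> /(can_inj (swapnK j)) ->].
have uS : uniq S by rewrite /= uniq_lt_pairs mem_lt_pairs /= ltnNge leqnSn.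
have M (x y : nat) :
    ((x, y) \in [seq (swapn j x.1, swapn j x.2) | x <- S]) = ((x, y) \in S).
  rewrite -{1}[x](swapnK j) -{1}[y](swapnK j).
  rewrite (mem_map inj S (swapn j x, swapn j y)) !inE !mem_lt_pairs /= !xpair_eqE /swapn.
  case: (eqVneq x j) => ?; case: (eqVneq x j.+1) => ?;
    case: (eqVneq y j) => ?; case: (eqVneq y j.+1) => ?; lia.
by apply: uniq_perm => // [|[x y]]; rewrite ?map_inj_uniq.
Qed.

(** Pairs avoiding [i] are the images under [bump i] of the pairs of the shorter row; pairs
    containing [i] are indexed by their other node [t]. The value $t=i$ adds the degenerate pair. *)
Lemma bump_pairs_perm i m : (i <= m)%N ->
  perm_eq ([seq (minn t i, maxn t i) | t <- iota 0 m.+1]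
           ++ [seq (bump i x.1, bump i x.2) | x <- lt_pairs m])
          ((i, i) :: lt_pairs m.+1).
Proof.
move=> im; have M (x y : nat) :
    ((x, y) \in [seq (minn t i, maxn t i) | t <- iota 0 m.+1]
           ++ [seq (bump i x.1, bump i x.2) | x <- lt_pairs m])
    = ((x, y) \in (i, i) :: lt_pairs m.+1).
  rewrite mem_cat [RHS]in_cons mem_lt_pairs xpair_eqE; apply/orP/orP.
    case=> [/mapP[t]|/mapP[[p q]]].
      rewrite mem_iota /= => tm [-> ->]; lia.
    by rewrite mem_lt_pairs /= => pq [-> ->]; rewrite /bump;
      case: (leqP i p) => ?; case: (leqP i q) => ?; lia.
  move=> H; have {}H : (x == i) && (y == i) \/ (x < y < m.+1)%N := H.
  have [xi|xi] := eqVneq x i.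
    left; apply/mapP; exists y; rewrite ?mem_iota; first lia.
    by congr (_, _); lia.
  have [yi|yi] := eqVneq y i.
    left; apply/mapP; exists x; rewrite ?mem_iota; first lia.
    by congr (_, _); lia.
  right; apply/mapP; exists (unbump i x, unbump i y); last by rewrite /= !unbumpK.
  by rewrite mem_lt_pairs /= /unbump; lia.
apply: uniq_perm => [||[x y]]; last exact: M.
- rewrite cat_uniq; apply/and3P; split.
  + by rewrite map_inj_uniq ?iota_uniq // => t t' [e1 e2]; lia.
  + apply/hasPn => _ /mapP[[p q] _ ->]; apply/mapP => -[t _ [e1 e2]].
    by move: (neq_bump i p) (neq_bump i q) e1 e2 => /=; lia.
  + by rewrite map_inj_uniq ?uniq_lt_pairs //
      => -[p q] [p' q'] [/(can_inj (bumpK i)) -> /(can_inj (bumpK i)) ->].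
- by rewrite /= uniq_lt_pairs mem_lt_pairs ltnn.
Qed.

Lemma big_iota_single (V : nmodType) n i0 (F : nat -> V) : (i0 < n)%N ->
  (forall i, i != i0 -> F i = 0) -> \sum_(i <- iota 0 n) F i = F i0.
Proof.
move=> i0n F0; rewrite (bigD1_seq i0) ?iota_uniq ?mem_iota //=.
by rewrite big1 ?addr0.
Qed.

Section Alternation.
Variable R : comNzRingType.
Implicit Types (v k l : nat -> int) (F g : (nat -> int) -> R).

(** Vanishing on the diagonal is a separate requirement, since antisymmetry does not imply it in
    characteristic 2. *)
Definition alternating_at (j : nat) F : Prop :=
  (forall v, v j = v j.+1 -> F v = 0) /\ (forall v, F (fun i => v (swapn j i)) = - F v).

Lemma swapn_diag j v : v j = v j.+1 -> (fun i => v (swapn j i)) = v.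
Proof.
move=> vj; apply: functional_extensionality => i; rewrite /swapn.
by case: eqP => [->//|_]; case: eqP => [->|].
Qed.

(* Writing an alternating function as [g - g o sigma] keeps every later argument valid in characteristic 2. *)
Lemma alternatingP j F : alternating_at j F <->
  exists g, forall v, F v = g v - g (fun i => v (swapn j i)).
Proof.
split=> [[F0 FN]|[g Fg]].
  (* The witness is [F] cut off to the chamber $v_j<v_{j+1}$; its swapped copy supplies the opposite
     chamber. *)
  exists (fun v => if v j < v j.+1 then F v else 0) => v.
  have s0 : swapn j j = j.+1 by rewrite /swapn eqxx.
  have s1 : swapn j j.+1 = j by rewrite /swapn eqxx gtn_eqF.
  rewrite s0 s1; case: (ltgtP (v j) (v j.+1)) => [_|_|/F0 ->]; rewrite ?subr0 //.
  by rewrite FN sub0r opprK.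
split=> v; first by move=> vj; rewrite Fg swapn_diag // subrr.
rewrite !Fg opprB; congr (_ - g _).
by apply: functional_extensionality => i; rewrite swapnK.
Qed.

(** The base point 0 is common to all variables, so exchanging two sums only exchanges their upper
    bounds. *)
Lemma alternating_msum0 m j F : (j.+1 < m)%N -> alternating_at j F ->
  alternating_at j (fun l => msum m (fun=> 0) l F).
Proof.
move=> jm /alternatingP[g Fg]; apply/alternatingP.
exists (fun l => msum m (fun=> 0) l g) => l.
by rewrite -(msum_swap (fun=> 0) l g jm) -msumB; apply: eq_msum => v; rewrite Fg.
Qed.

Lemma alternating_shift_ops w j L F :
  perm_eq [seq (swapn j x.1, swapn j x.2) | x <- L] L ->
  alternating_at j F -> alternating_at j (shift_ops w L F).
Proof.
move=> pL /alternatingP[g Fg]; apply/alternatingP; exists (shift_ops w L g) => v.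
rewrite (shift_ops_reindex w L g v (can_inj (swapnK j))) (perm_shift_ops _ _ pL) -shift_opsB.
by congr shift_ops; apply: functional_extensionality.
Qed.

Lemma shift_ops_diag w j L F :
  (forall x, x \in L -> [&& x.1 != j, x.1 != j.+1, x.2 != j & x.2 != j.+1]) ->
  (forall v, v j = v j.+1 -> F v = 0) ->
  forall v, v j = v j.+1 -> shift_ops w L F v = 0.
Proof.
move=> + F0; elim: L => [//|x L IH] xL v vj /=.
rewrite /shift_op big1 // => a _; rewrite IH ?mulr0 // => [y yL|].
  by apply: xL; rewrite inE yL orbT.
have /and4P[h1 h2 h3 h4] := xL x (mem_head _ _).
by rewrite /arrow_shift !(eq_sym _ x.1) !(eq_sym _ x.2) !(negPf h1, negPf h2, negPf h3, negPf h4) vj.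
Qed.

(** * Alternating sums over a deleted coordinate *)

Section Antiderivative.
Variables (m : nat) (U : (nat -> int) -> R).
Hypothesis altU : forall j, (j.+1 < m)%N -> alternating_at j U.

Definition deletion_sum k : R :=
  \sum_(i <- iota 0 m.+1) (-1) ^+ i * U (fun t => k (bump i t)).

(** An upper end at $j$ and a lower end at $j+1$ both pick $k_{j+1}$, which alternation kills; the
    word with [i] lower ends picks every entry except $k_i$. *)
Lemma wsum_deletion_sum k :
  wsum m (fun s => U (pick_bound s k (fun i => k i.+1))) = deletion_sum k.
Proof.
rewrite wsum_monotone => [|s j jm sj sj'].
  apply: eq_bigr => i _; congr (_ * U _); apply: functional_extensionality => t.
  by rewrite /pick_bound /bump; case: ifP.
by apply: (altU jm).1; rewrite /pick_bound sj sj'.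
Qed.

(** The swap exchanges the terms deleting $j$ and $j+1$, which carry opposite signs; in every other
    term the two coordinates stay adjacent and [U] itself alternates. *)
Lemma alternating_deletion_sum j : (j < m)%N -> alternating_at j deletion_sum.
Proof.
move=> jm.
have split2 k : exists2 r : R, deletion_sum k = r +
    (-1) ^+ j * (U (fun t => k (bump j t)) - U (fun t => k (bump j.+1 t))) &
    r = \sum_(i <- iota 0 m.+1 | (i != j) && (i != j.+1)) (-1) ^+ i * U (fun t => k (bump i t)).
  eexists; last by [].
  have mj : j \in iota 0 m.+1 by rewrite mem_iota add0n leq0n ltnS ltnW.
  rewrite /deletion_sum (bigD1_seq j mj (iota_uniq _ _)).
  have mS : j.+1 \in [seq i <- iota 0 m.+1 | i != j].
    by rewrite mem_filter mem_iota add0n ltnS jm gtn_eqF.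
  rewrite -big_filter (bigD1_seq j.+1 mS (filter_uniq _ (iota_uniq _ _))).
  rewrite big_filter_cond exprS.
  rewrite /= addrA addrC; congr (_ + _).
  by rewrite mulN1r mulNr -mulrBr.
have bumpjS t : bump j.+1 t = swapn j (bump j t).
  by rewrite /swapn /bump; do ![case: eqP => ?|case: leqP => ? /=]; lia.
have bumpjS' t : swapn j (bump j.+1 t) = bump j t by rewrite bumpjS swapnK.
have alt_other : forall k i, (i != j) && (i != j.+1) && (i <= m)%N ->
  (k j = k j.+1 -> U (fun t => k (bump i t)) = 0) /\
  U (fun t => k (swapn j (bump i t))) = - U (fun t => k (bump i t)).
  (* Deleting an index below $j$ moves the two coordinates to positions $j-1$ and $j$; deleting one
     above $j+1$ leaves them in place. *)
  move=> k i /andP[/andP[ij ij1] im]; have [lt_ij|le_ji] := ltnP i j.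
    have jm' : (j.-1.+1 < m)%N by lia.
    have [U0 UN] := altU jm'; split=> [kj|].
      have b0 : bump i j.-1 = j by rewrite /bump; lia.
      have b1 : bump i j.-1.+1 = j.+1 by rewrite /bump; lia.
      by apply: U0; rewrite b0 b1.
    rewrite -UN; congr U; apply: functional_extensionality => t; congr k.
    by rewrite /swapn /bump; do ![case: eqP => ?|case: leqP => ? /=]; lia.
  have jm' : (j.+1 < m)%N by lia.
  have [U0 UN] := altU jm'; split=> [kj|].
    have b0 : bump i j = j by rewrite /bump; lia.
    have b1 : bump i j.+1 = j.+1 by rewrite /bump; lia.
    by apply: U0; rewrite b0 b1.
  rewrite -UN; congr U; apply: functional_extensionality => t; congr k.
  by rewrite /swapn /bump; do ![case: eqP => ?|case: leqP => ? /=]; lia.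
split=> k.
  move=> kj; have [r -> ->] := split2 k.
  have -> : U (fun t => k (bump j t)) = U (fun t => k (bump j.+1 t)).
    congr U; apply: functional_extensionality => t; rewrite bumpjS.
    by rewrite -[in LHS](swapn_diag kj).
  rewrite subrr mulr0 addr0 big_seq_cond big1 // => i /andP[].
  rewrite mem_iota => im ij; rewrite (alt_other k i _).1 ?mulr0 //; lia.
have [r -> ->] := split2 k; have [r' -> ->] := split2 (fun i => k (swapn j i)).
rewrite opprD -mulrN opprB -sumrN; congr (_ + _ * (U _ - U _)).
- rewrite !(big_seq_cond (fun i => (i != j) && _)); apply: eq_bigr => i /andP[].
  by rewrite mem_iota => im ij; rewrite (alt_other k i _).2 ?mulrN //; lia.
- by apply: functional_extensionality => t; rewrite bumpjS.
- by apply: functional_extensionality => t; rewrite bumpjS'.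
Qed.

End Antiderivative.

Lemma msum_deletion_sum m H k : (forall j, (j.+1 < m)%N -> alternating_at j H) ->
  msum m k (fun i => k i.+1) H = deletion_sum m (fun l => msum m (fun=> 0) l H) k.
Proof.
move=> altH; rewrite msum_wsum.
apply: (@wsum_deletion_sum m (fun l => msum m (fun=> 0) l H)) => j jm.
by apply: alternating_msum0 => //; apply: altH.
Qed.

Lemma deco_msum w m H k :
  depends_on_first m H -> (forall j, (j.+1 < m)%N -> alternating_at j H) ->
  deco_sum w m.+1 (fun d =>
    msum m (fun j => k j + eps (d j)) (fun j => k j.+1 - delta (d j.+1))
      (shift_ops w (lt_pairs m) H))
  = (\sum_(a <- arrows) w a)
    * shift_ops w (lt_pairs m.+1) (fun v => msum m v (fun i => v i.+1) H) k.
Proof.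
move=> dH altH; set U := fun l => msum m (fun=> 0) l H.
have altU j : (j.+1 < m)%N -> alternating_at j U.
  by move=> jm; apply/alternating_msum0/altH.
have dU : depends_on_first m U by apply: msum_dep.
set V := shift_ops w (lt_pairs m) U.
have dV : depends_on_first m V by apply: shift_ops_dep.
under eq_deco_sum => d do rewrite wsum_msum_shift_ops //.
rewrite deco_sum_wsum wsum_monotone; last first.
  move=> s j jm sj sj'.
  (* the dummy index [m] is harmless as [V] only depends on the first [m] coordinates *)
  pose p i := if s i then m else i.
  pose q i := if i is i'.+1 then if s i' then i' else m else m.
  (* The arrow of node $i$ is felt through [eps] only if $l_i$ takes its lower end, and through
     [delta] only if $l_{i-1}$ takes its upper end. *)
  transitivity (shift_ops w [seq (p i, q i) | i <- iota 0 m.+1] V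
                  (pick_bound s k (fun i => k i.+1))).
    rewrite -deco_sum_shift_ops; apply: eq_deco_sum => d; apply: dV => t tm.
    rewrite sumrB; rewrite [X in _ + (X - _)](_ : _ = if s t then 0 else eps (d t)); last first.
      rewrite (@big_iota_single _ _ t) => [||i it]; last 2 first.
      - by rewrite ltnS ltnW.
      - rewrite /p; case: ifP => _; first by rewrite ltn_eqF.
        by rewrite eq_sym (negPf it).
      by rewrite /p; case: ifP => _; rewrite ?(ltn_eqF tm) ?eqxx.
    rewrite [X in _ + (_ - X)](_ : _ = if s t then delta (d t.+1) else 0); last first.
      rewrite (@big_iota_single _ _ t.+1) => [||[|i] it] //; last 2 first.
      - by rewrite /q ltn_eqF.
      - rewrite /q; case: ifP => _; last by rewrite ltn_eqF.
        by rewrite eq_sym (negPf (_ : i != t)).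
      by rewrite /q; case: ifP => _; rewrite ?(ltn_eqF tm) ?eqxx.
    by rewrite /pick_bound; case: ifP => _; rewrite ?sub0r ?subr0.
  have mem_j : j.+1 \in iota 0 m.+1 by rewrite mem_iota /=; lia.
  (* Node $j+1$ is felt in both ways, at positions in reversed order; its operator is singled out
     and joined to [V]. *)
  have ej : (p j.+1, q j.+1) = (j.+1, j) by rewrite /p /q sj sj'.
  rewrite (perm_shift_ops _ _ (perm_map (fun i => (p i, q i)) (perm_to_rem mem_j))).
  rewrite map_cons ej shift_ops_cons.
  apply: (@shift_ops_diag w j).
  - move=> x /mapP[i]; rewrite mem_rem_uniq ?iota_uniq // inE mem_iota => /andP[ij im] -> /=.
    have pj : (p i != j) && (p i != j.+1).
      rewrite /p; case E: (s i); first lia.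
      by rewrite ij andbT; apply/eqP => ei; rewrite ei sj in E.
    have qj : (q i != j) && (q i != j.+1).
      rewrite /q; case: i ij {im pj} => [|i] ij; first lia.
      case E: (s i); last lia.
      by rewrite (_ : i != j) //; apply/eqP => ei; rewrite ei sj' in E.
    by case/andP: pj => -> ->; case/andP: qj => -> ->.
  (* The reversed pair completes [lt_pairs m] to a family invariant under the swap, so the diagonal
     is still a zero set. *)
  - have [D0 _] := alternating_shift_ops w (swapn_pairs_perm jm) (altU _ jm).
    exact: D0.
  - by rewrite /pick_bound sj sj'.
have -> : (fun v => msum m v (fun i => v i.+1) H) = deletion_sum m U.
  by apply: functional_extensionality => v; rewrite msum_deletion_sum.
rewrite shift_ops_lin mulr_sumr !(big_seq _ _ (iota 0 m.+1)).
apply: eq_bigr => i; rewrite mem_iota add0n leq0n ltnS andTb => im.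
rewrite mulrCA; congr (_ * _).
(* With [i] lower ends, a node $t<i$ raises $k_t$ and a node $t>i$ lowers $k_t$. The other half of
   each operator is sent to coordinate $i$, which has been deleted. *)
transitivity (shift_ops w ([seq (minn t i, maxn t i) | t <- iota 0 m.+1]
    ++ [seq (bump i x.1, bump i x.2) | x <- lt_pairs m]) (fun v => U (fun t => v (bump i t))) k).
  rewrite shift_ops_cat -deco_sum_shift_ops; apply: eq_deco_sum => d.
  rewrite -(shift_ops_reindex w _ _ _ (can_inj (bumpK i))); apply: dV => t tm.
  rewrite sumrB /pick_bound; have [it|it] := leqP i t.
    have -> : bump i t = t.+1 by rewrite /bump it.
    rewrite big1 => [|t' _]; last by rewrite (_ : (t.+1 == minn t' i) = false) //; lia.
    rewrite sub0r; congr (_ - _).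
    rewrite (@big_iota_single _ _ t.+1) => [|//|t' tt']; last first.
      by rewrite (_ : (t.+1 == maxn t' i) = false) //; lia.
    by rewrite (_ : (t.+1 == maxn t.+1 i)) //; lia.
  have -> : bump i t = t by rewrite /bump leqNgt it.
  rewrite [X in _ + (_ - X)]big1 => [|t' _]; last first.
    by rewrite (_ : (t == maxn t' i) = false) //; lia.
  rewrite subr0; congr (_ + _).
  rewrite (@big_iota_single _ _ t) => [||t' tt']; last 2 first.
  - lia.
  - by rewrite (_ : (t == minn t' i) = false) //; lia.
  by rewrite (_ : (t == minn t i)) //; lia.
rewrite (perm_shift_ops _ _ (bump_pairs_perm im)) shift_ops_cons -shift_opsZ.
congr shift_ops; apply: functional_extensionality => v.
(* The pair $(i,i)$ shifts only the deleted coordinate, so it reduces to the total weight. *)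
rewrite /shift_op mulr_suml; apply: eq_bigr => a _; congr (_ * U _).
apply: functional_extensionality => t; rewrite /arrow_shift /=.
by rewrite eq_sym (negPf (neq_bump i t)) addr0 subr0.
Qed.

End Alternation.

(** * The recursion for arrowed monotone triangles *)

Definition unstaircase (v : nat -> int) (n : nat) : seq int :=
  mkseq (fun j => v j - j%:Z) n.

Definition content (n : nat) (v : nat -> int) : int :=
  \sum_(i <- iota 0 n) (v i - i%:Z).

Lemma sum_unstaircase v n : \sum_(x <- unstaircase v n) x = content n v.
Proof. by rewrite big_map. Qed.

Lemma unstaircase_dep n : depends_on_first n (fun v => unstaircase v n).
Proof.
move=> u v uv; apply: (@eq_from_nth _ 0); rewrite !size_mkseq // => i im.
by rewrite !nth_mkseq // uv.
Qed.

Lemma content_dep n : depends_on_first n (content n).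
Proof. by move=> u v uv; rewrite -!sum_unstaircase (unstaircase_dep uv). Qed.

Lemma content_arrow_shift a p q n v : (p < n)%N -> (q < n)%N ->
  content n (arrow_shift a p q v) = content n v + (eps a - delta a).
Proof.
move=> pn qn; rewrite /content /arrow_shift.
have -> : eps a - delta a = \sum_(i <- iota 0 n) (eps a *+ (i == p) - delta a *+ (i == q)).
  rewrite sumrB (big_iota_single pn) => [|i /negPf -> //].
  by rewrite (big_iota_single qn) ?eqxx // => i /negPf ->.
by rewrite -big_split; apply: eq_bigr => i _ /=; ring.
Qed.

Lemma content_swapn j n v : (j.+1 < n)%N -> content n (fun i => v (swapn j i)) = content n v.
Proof.
move=> jn; rewrite /content !sumrB; congr (_ - _).
rewrite -(big_map (swapn j) xpredT v); apply: perm_big.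
apply: uniq_perm; rewrite ?(map_inj_uniq (can_inj (swapnK j))) ?iota_uniq // => x.
rewrite -{1}[x](swapnK j) mem_map ?mem_iota; last exact: (can_inj (swapnK j)).
by rewrite /swapn /=; case: eqP => ?; [|case: eqP => ?]; lia.
Qed.

Lemma mkseqS (T : Type) (f : nat -> T) n : mkseq f n.+1 = f 0%N :: mkseq (fun i => f i.+1) n.
Proof. by rewrite /mkseq /= (iotaDl 1 0) -map_comp. Qed.

Lemma ends_mkseq r d n :
  ends (mkseq r n.+1) (mkseq d n.+1)
  = mkseq (fun j => (r j + eps (d j), r j.+1 - delta (d j.+1))) n.
Proof.
rewrite /ends; elim: n r d => [//|n IH] r d.
by rewrite mkseqS [mkseq d _]mkseqS [RHS]mkseqS -IH mkseqS [mkseq (fun i => d i.+1) _]mkseqS.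
Qed.

Section Recursion.
Variables (R : fieldType).
Implicit Types (w : arrow -> R) (X : nat -> R).

Lemma sum_choices_cons l ls (f : seq int -> R) :
  \sum_(r <- choices (l :: ls)) f r = \sum_(x <- l) \sum_(s <- choices ls) f (x :: s).
Proof. exact: (@big_allpairs_dep R 0 +%R _ _ _ (fun x s => x :: s) l (fun=> choices ls)). Qed.

Lemma sum_decosS n (f : seq arrow -> R) :
  \sum_(d <- decos n.+1) f d = \sum_(a <- arrows) \sum_(d <- decos n) f (a :: d).
Proof. exact: (@big_allpairs_dep R 0 +%R _ _ _ (fun a d => a :: d) arrows (fun=> decos n)). Qed.

(** Signs and ranges factor over the entries, so [sint_sum] applies to one entry at a time; its
    half-open form is the source of the [+ 1]. *)
Lemma sum_choices_sint m (e : nat -> int * int) (f : seq int -> R) :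
  \sum_(r <- choices [seq sint_elems x.1 x.2 | x <- mkseq e m])
    (-1) ^+ count (fun x => sint_neg x.1 x.2) (mkseq e m) * f r
  = msum m (fun j => (e j).1) (fun j => (e j).2 + 1) (fun v => f (mkseq v m)).
Proof.
elim: m e f => [|m IH] e f; first by rewrite /= big_seq1 mul1r.
rewrite mkseqS map_cons sum_choices_cons [RHS]/= -sint_sum mulr_sumr.
apply: eq_bigr => x _.
have -> : (fun v => f (mkseq (scons x v) m.+1)) = (fun v => f (x :: mkseq v m)).
  by apply: functional_extensionality => v; rewrite mkseqS.
rewrite -(IH (fun i => e i.+1) (fun s => f (x :: s))) mulr_sumr.
by apply: eq_bigr => s _; rewrite exprD mulrA.
Qed.

Lemma msum_unstaircase m a b (f : seq int -> R) :
  msum m (fun j => a j - j%:Z) (fun j => b j - j%:Z) (fun l => f (mkseq l m))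
  = msum m a b (fun l => f (unstaircase l m)).
Proof.
set F := fun l => f (unstaircase l m).
have dF : depends_on_first m F by move=> u u' uu; rewrite /F (unstaircase_dep uu).
transitivity (msum m (fun j => a j - j%:Z) (fun j => b j - j%:Z)
    (fun l => F (fun i => l i + i%:Z))).
  apply: eq_msum => l.
  by rewrite /F /unstaircase; congr f; apply: eq_mkseq => i; rewrite addrK.
rewrite -(msum_shift _ _ (fun i => i%:Z) dF).
by apply: msum_bounds => i _; rewrite subrK.
Qed.

Lemma sum_decos w n (phi : seq arrow -> R) :
  \sum_(d <- decos n) (\prod_(a <- d) w a) * phi d
  = deco_sum w n (fun d => phi (mkseq d n)).
Proof.
elim: n phi => [|n IH] phi; first by rewrite /= big_seq1 big_nil mul1r.
rewrite sum_decosS [RHS]/=; apply: eq_bigr => a _.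
have -> : (fun d => phi (mkseq (scons a d) n.+1)) = (fun d => phi (a :: mkseq d n)).
  by apply: functional_extensionality => d; rewrite mkseqS.
rewrite -(IH (fun d => phi (a :: d))) mulr_sumr.
by apply: eq_bigr => d _; rewrite big_cons mulrA.
Qed.

(** Absorbs the variable of the bottom row: $\#\nearrow-\#\nwarrow$ is the sum of [eps a - delta a],
    to which [NWNE] contributes 0. *)
Definition twist w (x : R) (a : arrow) : R := w a * x ^ (eps a - delta a).

Lemma prod_twist w x d : x != 0 ->
  \prod_(a <- d) twist w x a
  = (\prod_(a <- d) w a) * x ^ ((count isNE d)%:Z - (count isNW d)%:Z).
Proof.
move=> x0; elim: d => [|a d IH]; first by rewrite !big_nil subrr expr0z mulr1.
rewrite !big_cons IH /twist [LHS]mulrACA -expfzDr //; congr (_ * _ ^ _).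
by case: a => /=; lia.
Qed.

Lemma sum_twist w x :
  \sum_(a <- arrows) twist w x a = w NE * x + w NW * x^-1 + w NWNE + w EMP.
Proof.
by rewrite /arrows !big_cons big_nil /twist /= subr0 sub0r subrr !expr0z expr1z exprN1 !mulr1 addr0 !addrA.
Qed.

(** Each arrow multiplies [x ^ content n v] by [x ^ (eps a - delta a)], so pulling the power out of
    the operators twists their weights. *)
Lemma shift_ops_twist w x n L (F : (nat -> int) -> R) v : x != 0 ->
  (forall y, y \in L -> (y.1 < n) && (y.2 < n))%N ->
  shift_ops w L (fun u => x ^ content n u * F u) v
  = x ^ content n v * shift_ops (twist w x) L F v.
Proof.
move=> x0; elim: L v => [//|y L IH] v yL /=.
have /andP[y1 y2] := yL _ (mem_head _ _).
rewrite /shift_op mulr_sumr; apply: eq_bigr => a _.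
rewrite IH => [|z zL]; last by apply: yL; rewrite inE zL orbT.
by rewrite content_arrow_shift // expfzDr // /twist; ring.
Qed.

(** Signed Gelfand-Tsetlin patterns in the coordinates $v$; for nonzero variables this is the
    extended Schur polynomial, by [ext_schur_signed_gt], described without sorting. *)
Fixpoint signed_gt X (n : nat) (v : nat -> int) : R :=
  if n is m.+1 then
    msum m v (fun i => v i.+1)
      (fun l => X m.+1 ^ (content m.+1 v - content m l) * signed_gt X m l)
  else 1.

Lemma signed_gt_dep X n : depends_on_first n (signed_gt X n).
Proof.
case: n => [|n] u v uv //=; rewrite (content_dep uv).
by apply: msum_bounds => i im; apply: uv; rewrite ltnS // ltnW.
Qed.

Lemma signed_gtS X m v : X m.+1 != 0 ->
  signed_gt X m.+1 v = X m.+1 ^ content m.+1 v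
    * msum m v (fun i => v i.+1) (fun l => X m.+1 ^ (- content m l) * signed_gt X m l).
Proof.
move=> x0; rewrite /= -msumZ; apply: eq_msum => l.
by rewrite expfzDr // mulrA.
Qed.

(** By induction the summand alternates, so the signed sum is a deletion sum of an alternating
    antiderivative; the power of the content split off in [signed_gtS] is symmetric. *)
Lemma signed_gt_alternating X n j : (forall i : nat, (0 < i <= n)%N -> X i != 0) ->
  (j.+1 < n)%N -> alternating_at j (signed_gt X n).
Proof.
elim: n j => [//|m IH] j X0 jm.
have Xm : X m.+1 != 0 by apply: X0; rewrite leqnn.
set H := fun l => X m.+1 ^ (- content m l) * signed_gt X m l.
have altH i : (i.+1 < m)%N -> alternating_at i H.
  move=> im; have [G0 GN] : alternating_at i (signed_gt X m).
    by apply: IH => // t /andP[t0 tm]; apply: X0; rewrite t0 leqW.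
  split=> v; first by move=> vi; rewrite /H G0 ?mulr0.
  by rewrite /H GN content_swapn // mulrN.
have [D0 DN] : alternating_at j (fun v => msum m v (fun i => v i.+1) H).
  have -> : (fun v => msum m v (fun i => v i.+1) H)
          = deletion_sum m (fun l => msum m (fun=> 0) l H).
    by apply: functional_extensionality => v; rewrite msum_deletion_sum.
  by apply: alternating_deletion_sum => // i im; apply/alternating_msum0/altH.
split=> v; rewrite !signed_gtS //; first by move=> vj; rewrite D0 ?mulr0.
by rewrite content_swapn // DN mulrN.
Qed.

Lemma emt_gf_recursion w X m v : X m.+1 != 0 ->
  emt_gf w X m.+1 (unstaircase v m.+1)
  = deco_sum (twist w (X m.+1)) m.+1 (fun d =>
      msum m (fun j => v j + eps (d j)) (fun j => v j.+1 - delta (d j.+1))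
        (fun l => X m.+1 ^ (content m.+1 v - content m l)
                  * emt_gf w X m (unstaircase l m))).
Proof.
move=> x0; set r := unstaircase v m.+1; set x := X m.+1.
pose f r' := x ^ (content m.+1 v - \sum_(y <- r') y) * emt_gf w X m r'.
pose phi d := \sum_(r' <- choices [seq sint_elems e.1 e.2 | e <- ends r d])
    (-1) ^+ count (fun e => sint_neg e.1 e.2) (ends r d) * f r'.
transitivity (\sum_(d <- decos m.+1) (\prod_(a <- d) twist w x a) * phi d).
  apply: eq_bigr => d _; rewrite mulr_sumr; apply: eq_bigr => r' _.
  rewrite -/(emt_gf w X m r') /r sum_unstaircase prod_twist // /f -/x -addrA.
  by rewrite (expfzDr _ _ x0); ring.
rewrite sum_decos; apply: eq_deco_sum => d.
rewrite /phi /r ends_mkseq sum_choices_sint.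
under [RHS]eq_msum => l do rewrite -(sum_unstaircase l m).
rewrite -(msum_unstaircase _ _ _ f).
(* The [+ 1] of the half-open bound turns the staircase offset $j+1$ of the right neighbour into
   $j$, so both ends are offset by the same $j$. *)
by apply: msum_bounds => i _ /=; lia.
Qed.

Lemma emt_gf_signed_gt w X n v : (forall i : nat, (0 < i <= n)%N -> X i != 0) ->
  emt_gf w X n (unstaircase v n) =
  \prod_(1 <= i < n.+1) (w NE * X i + w NW * (X i)^-1 + w NWNE + w EMP)
  * shift_ops w (lt_pairs n) (signed_gt X n) v.
Proof.
elim: n v => [|m IH] v X0; first by rewrite big_nil mul1r.
have Xm : X m.+1 != 0 by apply: X0; rewrite leqnn.
have X0' i : (0 < i <= m)%N -> X i != 0.
  by move=> /andP[i0 im]; apply: X0; rewrite i0 leqW.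
rewrite emt_gf_recursion //; set x := X m.+1 in Xm *.
pose c := \prod_(1 <= i < m.+1) (w NE * X i + w NW * (X i)^-1 + w NWNE + w EMP).
pose H l := x ^ (- content m l) * signed_gt X m l.
have dH : depends_on_first m H.
  by move=> u u' uu; rewrite /H (content_dep uu) (signed_gt_dep X uu).
have altH j : (j.+1 < m)%N -> alternating_at j H.
  move=> jm; have [G0 GN] := signed_gt_alternating X0' jm.
  split=> u; first by move=> uj; rewrite /H G0 ?mulr0.
  by rewrite /H GN content_swapn // mulrN.
have bound k y : y \in lt_pairs k -> (y.1 < k)%N && (y.2 < k)%N.
  by rewrite mem_lt_pairs => /andP[y12 yk]; rewrite yk (ltn_trans y12).
(* Writing [signed_gt X m] as [x ^ content m u * H u] twists the operators, and the power that comes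
   out cancels [x ^ (- content m l)]. *)
have E l : x ^ (content m.+1 v - content m l) * emt_gf w X m (unstaircase l m)
    = x ^ content m.+1 v * c * shift_ops (twist w x) (lt_pairs m) H l.
  rewrite IH // -/c expfzDr // -!mulrA; congr (_ * _).
  rewrite mulrCA; congr (_ * _).
  have -> : signed_gt X m = (fun u => x ^ content m u * H u).
    by apply: functional_extensionality => u; rewrite /H mulrA -expfzDr // subrr expr0z mul1r.
  rewrite (shift_ops_twist _ _ _ Xm (@bound m)).
  by rewrite mulrA -expfzDr // addNr expr0z mul1r.
transitivity (x ^ content m.+1 v * c * deco_sum (twist w x) m.+1 (fun d =>
    msum m (fun j => v j + eps (d j)) (fun j => v j.+1 - delta (d j.+1))
      (shift_ops (twist w x) (lt_pairs m) H))).
  rewrite -deco_sumZ; apply: eq_deco_sum => d; rewrite -msumZ.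
  by apply: eq_msum => l; rewrite E.
rewrite deco_msum // sum_twist.
(* The same twist, read backwards one row below, restores the weights [w]; the sum of twisted
   weights becomes the new factor of the product. *)
have -> : signed_gt X m.+1
    = (fun u => x ^ content m.+1 u * msum m u (fun i => u i.+1) H).
  by apply: functional_extensionality => u; rewrite signed_gtS.
rewrite (shift_ops_twist _ _ _ Xm (@bound m.+1)) big_nat_recr //= -/c -/x; ring.
Qed.

End Recursion.

(** * Comparison with the extended Schur polynomials *)

Lemma shiftv_unstaircase n v p c : (0 < p <= n)%N ->
  shiftv (unstaircase v n) p c = unstaircase (fun t => v t + c *+ (t == p.-1)) n.
Proof.
move=> /andP[p0 pn]; have pn' : (p.-1 < n)%N by lia.
apply: (@eq_from_nth _ 0) => [|i].
  by rewrite size_set_nth !size_mkseq; apply/maxn_idPr.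
rewrite size_set_nth !size_mkseq (maxn_idPr pn') => im.
rewrite nth_set_nth /= !nth_mkseq //; case: eqP => [->|_]; last by rewrite addr0.
by rewrite mulr1n addrAC.
Qed.

Lemma pairs_perm n : perm_eq [seq (x.1.-1, x.2.-1) | x <- pairs n] (lt_pairs n).
Proof.
have mem_pairs (x : nat * nat) : (x \in pairs n) = (0 < x.1 < x.2)%N && (x.2 <= n)%N.
  apply/allpairsPdep/idP => [[p [q [+ + ->]]]|]; first by rewrite !mem_iota /=; lia.
  case: x => p q /= H; exists p, q; rewrite !mem_iota; split=> //; lia.
have M (p q : nat) : ((p, q) \in [seq (x.1.-1, x.2.-1) | x <- pairs n])
    = ((p, q) \in lt_pairs n).
  rewrite mem_lt_pairs; apply/mapP/idP => [[[a b]]|/= H].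
    by rewrite mem_pairs /= => H [-> ->]; lia.
  by exists (p.+1, q.+1); rewrite ?mem_pairs //=; lia.
apply: uniq_perm => [||[p q]]; [|exact: uniq_lt_pairs|exact: M].
rewrite map_inj_in_uniq.
  by apply: allpairs_uniq_dep => [|x _|[a b] [c d] _ _ [-> ->]] //; exact: iota_uniq.
move=> [a b] [c d]; rewrite !mem_pairs /= => H1 H2 [e1 e2]; congr (_, _); lia.
Qed.

Lemma big_op_unstaircase (R : fieldType) (w : arrow -> R) n f v :
  big_op w n f (unstaircase v n)
  = shift_ops w (lt_pairs n) (fun u => f (unstaircase u n)) v.
Proof.
rewrite -(perm_shift_ops w _ (pairs_perm n)) /big_op.
have : {in pairs n, forall x, (0 < x.1 <= n)%N && (0 < x.2 <= n)%N}.
  move=> x /allpairsPdep[p [q [+ + ->]]]; rewrite !mem_iota /=; lia.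
elim: (pairs n) v => [//|[p q] L IH] v HL /=.
have /andP[/= pn qn] := HL _ (mem_head _ _).
have {}IH u := IH u (fun x xL => HL x (mem_behead (s := (p, q) :: L) xL)).
rewrite /pair_op /Eop /Einv /shift_op /arrows !big_cons big_nil addr0.
rewrite !shiftv_unstaircase // !IH !addrA.
have E (u u' : nat -> int) : u =1 u' -> forall g : (nat -> int) -> R, g u = g u'.
  by move=> /functional_extensionality ->.
congr (_ * _ + _ * _ + _ * _ + _ * _); apply: E => t;
  by rewrite /arrow_shift /= ?mul0rn ?addr0 ?subr0 ?mulNrn.
Qed.

Lemma mem_choices (ls : seq (seq int)) s : s \in choices ls ->
  size s = size ls /\ forall j, (j < size ls)%N -> nth 0 s j \in nth [::] ls j.
Proof.
elim: ls s => [|l ls IH] s /=; first by rewrite inE => /eqP ->.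
case/allpairsP => -[x s'] [/= xl /IH[ss' s'ls] ->]; split=> /=; first by rewrite ss'.
by case=> [|j] //= /s'ls.
Qed.

Lemma mem_int_range a b x : x \in int_range a b -> a <= x <= b.
Proof.
rewrite /int_range; case: ifP => // ab /mapP[i]; rewrite mem_iota => im ->; lia.
Qed.

Section Schur.
Variable R : fieldType.
Implicit Types (X : nat -> R) (v : nat -> int).

Lemma sum_choices_cat l1 l2 (f : seq int -> R) :
  \sum_(s <- choices (l1 ++ l2)) f s
  = \sum_(s1 <- choices l1) \sum_(s2 <- choices l2) f (s1 ++ s2).
Proof.
elim: l1 f => [|l l1 IH] f; first by rewrite big_seq1.
by rewrite cat_cons !sum_choices_cons; apply: eq_bigr => x _; rewrite IH.
Qed.

Lemma sum_choices_rev ls (f : seq int -> R) :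
  \sum_(s <- choices (rev ls)) f s = \sum_(s <- choices ls) f (rev s).
Proof.
elim: ls f => [|l ls IH] f; first by rewrite !big_seq1.
rewrite rev_cons -cats1 sum_choices_cat (IH (fun s1 => \sum_(s2 <- _) f (s1 ++ s2))).
rewrite sum_choices_cons [RHS]exchange_big; apply: eq_bigr => s _.
rewrite sum_choices_cons; apply: eq_bigr => x _.
by rewrite big_seq1 rev_cons cats1.
Qed.

(** For strictly increasing [v] the row is weakly increasing, so all intervals are positive and no
    sign occurs; the reversal reflects that partitions are listed in decreasing order. *)
Lemma gt_schur_signed_gt X n v : (forall i, (i.+1 < n)%N -> v i < v i.+1) ->
  gt_schur X n (rev (unstaircase v n)) = signed_gt X n v.
Proof.
elim: n v => [//|m IH] v vlt.
pose r j : int := v j - j%:Z; pose e j : int * int := (r j, r j.+1).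
have er j : (j < m)%N -> (e j).1 <= (e j).2.
  by move=> jm; move: (vlt j jm); rewrite /e /r /=; lia.
have rangeE : [seq int_range x.2 x.1 | x <- zip (rev (unstaircase v m.+1))
      (behead (rev (unstaircase v m.+1)))]
    = rev [seq sint_elems x.1 x.2 | x <- mkseq e m].
  have sz : size (zip (rev (unstaircase v m.+1)) (behead (rev (unstaircase v m.+1)))) = m.
    by rewrite size_zip size_behead size_rev size_mkseq /=; apply/minn_idPr.
  apply: (@eq_from_nth _ [::]) => [|i]; rewrite size_map sz.
    by rewrite size_rev size_map size_mkseq.
  move=> im; rewrite (nth_map (0, 0)) ?sz // nth_zip_cond sz im /=.
  have szm : size [seq sint_elems x.1 x.2 | x <- mkseq e m] = m.
    by rewrite size_map size_mkseq.
  have szu : size (unstaircase v m.+1) = m.+1 by rewrite size_mkseq.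
  rewrite nth_behead !nth_rev ?szm ?szu //; last by rewrite ltnS ltnW.
  have im' : (m - i.+1 < m)%N by lia.
  rewrite (nth_map (0, 0)) ?size_mkseq // !nth_mkseq //; try lia.
  rewrite /sint_elems er // /e /r /=; congr (int_range (v _ - _) (v _ - _)); lia.
rewrite [LHS]/= rangeE sum_choices_rev.
pose f r' := X m.+1 ^ (content m.+1 v - \sum_(x <- r') x)
  * signed_gt X m (fun j => nth 0 r' j + j%:Z).
have c0 : count (fun x => sint_neg x.1 x.2) (mkseq e m) = 0%N.
  apply/eqP; rewrite -leqn0 leqNgt -has_count; apply/hasPn => x /mapP[j].
  rewrite mem_iota => jm ->; have := er j jm; rewrite /sint_neg -leNgt => h; lia.
transitivity (\sum_(r' <- choices [seq sint_elems x.1 x.2 | x <- mkseq e m])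
    (-1) ^+ count (fun x => sint_neg x.1 x.2) (mkseq e m) * f r').
  rewrite c0 [LHS]big_seq [RHS]big_seq; apply: eq_bigr => r' /mem_choices[].
  rewrite size_map size_mkseq => sr' mr'.
  rewrite expr0 mul1r /f -sum_unstaircase; congr (X _ ^ (_ - _) * _).
  - by apply: perm_big; rewrite perm_rev.
  - by apply: perm_big; rewrite perm_rev.
  rewrite -IH => [|i im].
    congr (gt_schur X m (rev _)); apply: (@eq_from_nth _ 0) => [|i].
      by rewrite size_mkseq.
    by rewrite sr' => im; rewrite nth_mkseq // addrK.
  have bnd j : (j < m)%N -> r j <= nth 0 r' j <= r j.+1.
    move=> jm; have := mr' j jm; rewrite (nth_map (0, 0)) ?size_mkseq // nth_mkseq //.
    by rewrite /sint_elems er // => /mem_int_range.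
  (* Interlacing gives $r'_i\le r_{i+1}\le r'_{i+1}$, which the staircase makes strict, as the
     induction requires. *)
  have /andP[_ h1] := bnd i (ltnW im); have /andP[h2 _] := bnd _ im.
  by rewrite -addn1 PoszD addrA ltzD1 lerD2r addn1; exact: le_trans h1 h2.
rewrite sum_choices_sint /=.
transitivity (msum m v (fun i => v i.+1) (fun l => f (unstaircase l m))).
  by rewrite -msum_unstaircase; apply: msum_bounds => i im //=; rewrite /r; lia.
apply: eq_msum => l; rewrite /f sum_unstaircase; congr (_ * _).
by apply: signed_gt_dep => i im; rewrite nth_mkseq // subrK.
Qed.

(** The content of a row with $m$ entries grows by $mp$, so each exponent, a difference of
    consecutive contents, grows by $p$. *)
Lemma signed_gt_shift X n v (p : nat) : (forall i : nat, (0 < i <= n)%N -> X i != 0) ->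
  signed_gt X n (fun i => v i + p%:Z)
  = (\prod_(1 <= i < n.+1) X i ^+ p) * signed_gt X n v.
Proof.
elim: n v => [|m IH] v X0; first by rewrite big_nil mul1r.
have Xm : X m.+1 != 0 by apply: X0; rewrite leqnn.
have X0' i : (0 < i <= m)%N -> X i != 0.
  by move=> /andP[i0 im]; apply: X0; rewrite i0 leqW.
have contentD k u : content k (fun i => u i + p%:Z) = content k u + p%:Z *+ k.
  have <- : \sum_(i <- iota 0 k) p%:Z = p%:Z *+ k.
    by rewrite big_const_seq count_predT size_iota iter_addr_0.
  by rewrite /content -big_split; apply: eq_bigr => i _; rewrite addrAC.
rewrite /= (@msum_shift _ m _ _ (fun=> p%:Z)); last first.
  by move=> u u' uu; rewrite (content_dep uu) (signed_gt_dep X uu).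
rewrite -msumZ; apply: eq_msum => l; rewrite IH // !contentD [X in _ = X * _]big_nat_recr //=.
rewrite (_ : _ - _ = p%:Z + (content m.+1 v - content m l)).
  by rewrite expfzDr // -exprnP; ring.
rewrite mulrS; ring.
Qed.

(** * From adjacent swaps to arbitrary permutations *)

Section AlternatingPerm.
Variables (n : nat) (F : (nat -> int) -> R).
Hypothesis depF : depends_on_first n F.
Hypothesis altF : forall j, (j.+1 < n)%N -> alternating_at j F.

Definition extend (u : 'I_n -> int) : nat -> int :=
  fun t => if insub t is Some i then u i else 0.

Lemma extendE u (i : 'I_n) : extend u i = u i.
Proof. by rewrite /extend valK. Qed.

Definition signed_perm (s : {perm 'I_n}) : Prop :=
  forall u, F (extend (fun i => u (s i))) = (-1) ^+ odd_perm s * F (extend u).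

Lemma signed_permM s t : signed_perm s -> signed_perm t -> signed_perm (s * t)%g.
Proof.
move=> Fs Ft u; rewrite odd_permM signr_addb -mulrA -Ft -Fs; congr (F (extend _)).
by apply: functional_extensionality => i; rewrite permM.
Qed.

Lemma signed_tperm (i j : 'I_n) : (i < j)%N -> signed_perm (tperm i j).
Proof.
move: {2}(j - i)%N (leqnn (j - i)) => d; elim: d i j => [|d IH] i j; first by lia.
move=> dij ij; have [e|ne] := eqVneq (i.+1) j.
  move=> u; rewrite odd_tperm neq_ltn ij expr1 mulN1r.
  have im : (i.+1 < n)%N by rewrite e.
  rewrite -(altF im).2; apply: depF => t tn.
  have -> : t = Ordinal tn by [].
  have sE : swapn i (Ordinal tn) = tperm i j (Ordinal tn).
    rewrite /swapn; case: tpermP => [->|->|/eqP ni /eqP nj]; first by rewrite eqxx.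
      by rewrite -e eqxx gtn_eqF.
    by rewrite (negPf (ni : (t != i)%N)) e (negPf (nj : (t != j)%N)).
  by rewrite sE !extendE.
have jn : (j.-1 < n)%N by apply: leq_ltn_trans (ltn_ord j); exact: leq_pred.
pose k := Ordinal jn.
have ik : (i < k)%N by rewrite /=; lia.
have kj : (k < j)%N by rewrite /=; lia.
(* Conjugating by the adjacent transposition of $k=j-1$ and $j$ shortens the distance by one. *)
have e : tperm i j = (tperm k j * tperm i k * tperm k j)%g.
  have nki : k != i by rewrite -val_eqE /= gtn_eqF.
  have nji : j != i by rewrite -val_eqE /= gtn_eqF.
  rewrite -[LHS](_ : (tperm i k ^ tperm k j)%g = _).
    by rewrite /conjg tpermV mulgA.
  by rewrite tpermJ tpermL tpermD.
have gik : signed_perm (tperm i k) by apply: IH => //=; lia.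
have gkj : signed_perm (tperm k j).
  by apply: IH => //=; lia.
by rewrite e; apply: signed_permM => //; apply: signed_permM.
Qed.

Lemma signed_permT s : signed_perm s.
Proof.
have [ts -> dts] := prod_tpermP s.
elim: ts dts => [_|[i j] ts IH /= /andP[ij dts]].
  rewrite big_nil => u; rewrite odd_perm1 expr0 mul1r; congr (F (extend _)).
  by apply: functional_extensionality => i; rewrite perm1.
rewrite big_cons; apply: signed_permM (IH dts) => /=.
move: ij; rewrite /dpair /= neq_ltn => /orP[|] ij; first exact: signed_tperm.
by rewrite tpermC; apply: signed_tperm.
Qed.

(** Exchanging $j$ with $j-1$ costs only a sign and brings the equal entries closer, until they are
    adjacent. *)
Lemma alternating_eq0 (u : 'I_n -> int) (i j : 'I_n) :
  (i < j)%N -> u i = u j -> F (extend u) = 0.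
Proof.
move: {2}(j - i)%N (leqnn (j - i)) => d; elim: d u i j => [|d IH] u i j; first by lia.
move=> dij ij uij; have [e|ne] := eqVneq (i.+1) j.
  have im : (i.+1 < n)%N by rewrite e.
  by apply: (altF im).1; rewrite e !extendE.
have jn : (j.-1 < n)%N by apply: leq_ltn_trans (ltn_ord j); exact: leq_pred.
pose k := Ordinal jn.
have ik : (i < k)%N by rewrite /=; lia.
have kj : (k < j)%N by rewrite /=; lia.
have nki : k != i by rewrite -val_eqE /= gtn_eqF.
have nji : j != i by rewrite -val_eqE /= gtn_eqF.
have := signed_permT (tperm k j) u; rewrite (IH _ i k) //=; first last.
- by rewrite tpermL tpermD.
- by rewrite /=; lia.
by move/esym/eqP; rewrite mulf_eq0 signr_eq0 => /eqP.
Qed.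

End AlternatingPerm.

Lemma exists_sorting_perm n (u : 'I_n -> int) : injective u ->
  exists s : {perm 'I_n}, forall i j : 'I_n, (i < j)%N -> u (s j) < u (s i).
Proof.
move=> inj_u; pose t := [tuple u i | i < n].
have geT : transitive (fun x y : int => y <= x) by move=> a b c ba cb; apply: le_trans cb ba.
pose st := sort (fun x y : int => y <= x) t.
have /tuple_permP[s Es] : perm_eq st t by rewrite perm_sort.
exists s => i j ij.
have sst : size st = n by rewrite size_sort size_tuple.
have srt : sorted (fun x y : int => y <= x) st.
  by apply: sort_sorted => x y; apply: le_total.
have nthE (k : 'I_n) : nth 0 st k = u (s k).
  by rewrite Es -tnth_nth tnth_mktuple tnth_mktuple.
have := sorted_ltn_nth geT 0 srt i j; rewrite !inE sst !ltn_ord => /(_ isT isT ij).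
rewrite !nthE lt_neqAle => ->; rewrite andbT; apply/eqP => /inj_u /perm_inj e.
by rewrite e ltnn in ij.
Qed.

Lemma ext_schur_signed_gt X lam :
  (forall i : nat, (0 < i <= size lam)%N -> X i != 0) ->
  ext_schur X lam
  = signed_gt X (size lam) (fun t => nth 0 (rev lam) t + t%:Z).
Proof.
move=> X0; rewrite /ext_schur; set n := size lam in X0 *.
set v := fun i : 'I_n => nth 0 lam i - (i : nat)%:Z.
(* [lam] lists the bottom row from right to left, so the coordinates are reversed. *)
pose F u := signed_gt X n (fun t => u (n.-1 - t)%N).
have depF : depends_on_first n F.
  by move=> a b ab; apply: signed_gt_dep => t tn; apply: ab; lia.
have altF j : (j.+1 < n)%N -> alternating_at j F.
  move=> jn; have jn' : ((n - j.+2).+1 < n)%N by lia.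
  have [G0 GN] := signed_gt_alternating X0 jn'; split=> a.
    move=> aj; apply: G0.
    rewrite (_ : (n.-1 - (n - j.+2) = j.+1)%N); last lia.
    by rewrite (_ : (n.-1 - (n - j.+2).+1 = j)%N) //; lia.
  rewrite -GN; apply: signed_gt_dep => t tn; congr a; rewrite /swapn.
  by case: (eqVneq t (n - j.+2)%N) => ?; case: (eqVneq t (n - j.+2).+1) => ?;
    case: (eqVneq (n.-1 - t)%N j) => ?; case: (eqVneq (n.-1 - t)%N j.+1) => ?; lia.
(* For $i=n-1-t$ this is $\lambda_i+t$, the staircase coordinate at the reversed position; the
   constant $n-1$ affects neither order nor coincidences. *)
pose u i := v i + n.-1%:Z.
have revE (a : 'I_n -> int) t : (t < n)%N ->
    exists2 i : 'I_n, i = (n.-1 - t)%N :> nat & extend a (n.-1 - t)%N = a i.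
  move=> tn; have h : (n.-1 - t < n)%N by lia.
  by exists (Ordinal h) => //; rewrite -(extendE a (Ordinal h)).
have -> : signed_gt X n (fun t => nth 0 (rev lam) t + t%:Z) = F (extend u).
  apply: signed_gt_dep => t tn; have [i ei ->] := revE u t tn.
  by rewrite nth_rev // /u /v ei (_ : (size lam - t.+1 = n.-1 - t)%N); lia.
case: ifPn => [/existsP[i /existsP[j /andP[ij /eqP vij]]]|vinj].
  by apply/esym/(alternating_eq0 depF altF ij); congr (_ + _); exact: vij.
have inj_u : injective u.
  move=> i j /addIr vij; apply: val_inj; apply/eqP; apply: contraNT vinj.
  rewrite neq_ltn => /orP[] ij; apply/existsP.
    by exists i; apply/existsP; exists j; rewrite ij; apply/eqP; exact: vij.
  by exists j; apply/existsP; exists i; rewrite ij; apply/eqP/esym; exact: vij.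
case: pickP => [s /forallP sP|noS]; last first.
  have [s sP] := exists_sorting_perm inj_u.
  have /negP[] := negbT (noS s); apply/forallP => i; apply/forallP => j; apply/implyP => ij.
  by have := sP i j ij; rewrite /u ltrD2r.
set mu0 := [seq _ | i <- enum 'I_n]; set p := (if _ then _ else _).
pose z t := extend (fun i => u (s i)) (n.-1 - t)%N + p%:Z.
have -> : [seq x + p%:Z | x <- mu0] = rev (unstaircase z n).
  have smu0 : size mu0 = n by rewrite size_map size_enum_ord.
  apply: (@eq_from_nth _ 0) => [|i]; first by rewrite size_map size_rev size_mkseq.
  rewrite size_map smu0 => im.
  rewrite (nth_map 0) ?smu0 // nth_rev ?size_mkseq // nth_mkseq; last lia.
  rewrite (nth_map (Ordinal im)) ?size_enum_ord // /z.
  rewrite (_ : (n.-1 - (n - i.+1) = i)%N); last lia.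
  rewrite (extendE _ (Ordinal im)) nth_enum_ord //.
  rewrite (_ : nth (Ordinal im) (enum 'I_n) i = Ordinal im); last first.
    by apply: val_inj; rewrite /= nth_enum_ord.
  rewrite /u /v. lia.
rewrite gt_schur_signed_gt => [|i im]; last first.
  rewrite /z ltrD2r.
  have [a ea ->] := revE (fun i => u (s i)) i (ltnW im).
  have [b eb ->] := revE (fun i => u (s i)) i.+1 im.
  have /forallP/(_ a)/implyP := sP b.
  by rewrite /u ltrD2r; apply; rewrite ea eb; lia.
(* The two signs of [s] multiply to 1, and the factor from the shift by [p] cancels $\prod_i
   X_i^{-p}$. *)
rewrite signed_gt_shift // -/(F _) (signed_permT depF altF).
rewrite [_ * (_ * F _)]mulrCA mulrA mulrAC -mulrA.
rewrite -(mulrA _ (\prod_(1 <= i < n.+1) _)) -big_split /= big_nat big1 => [|i i1n].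
  by rewrite mulr1 mulrA -signr_addb addbb mul1r.
by rewrite mulfV // expf_neq0 // X0.
Qed.

End Schur.

Theorem mainTheorem8 (R : fieldType) (w : arrow -> R) (X : nat -> R)
    (n : nat) (k : seq int) :
  size k = n ->
  (forall i : nat, (0 < i <= n)%N -> X i != 0) ->
  emt_gf w X n k =
  \prod_(1 <= i < n.+1) (w NE * X i + w NW * (X i)^-1 + w NWNE + w EMP)
  * big_op w n (fun k' => ext_schur X (rev k')) k.
Proof.
move=> sk X0; pose v t := nth 0 k t + t%:Z.
have -> : k = unstaircase v n.
  apply: (@eq_from_nth _ 0) => [|i]; rewrite ?size_mkseq // sk => im.
  by rewrite nth_mkseq // addrK.
rewrite emt_gf_signed_gt // big_op_unstaircase; congr (_ * shift_ops _ _ _ _).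
apply: functional_extensionality => u.
have su : size (rev (unstaircase u n)) = n by rewrite size_rev size_mkseq.
rewrite ext_schur_signed_gt su // revK; apply: signed_gt_dep => t tn.
by rewrite nth_mkseq // subrK.
Qed.
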